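(* Let $\nu>0$, assume $f\in C^{1,1}_\nu(\mathbb{R}^n)$, and assume $f(\mathbf{u})\ge f^\star$ for all $\mathbf{u}\in\mathbb{R}^n$, where $f^\star\in\mathbb{R}$. Run the basic simplicial search method (described in the context) on $f$ with radius $\delta>0$, and let $\mathbf{c}_k$ be the center (the average of the $n+1$ points) of $\Theta_k$ for iteration $k=0,1,\dots$. Then for any $k\ge1$, $$\frac1k\sum_{t=0}^{k-1}\|Df(\mathbf{c}_t)\|\le\frac{n^2}{2\delta k}\Big[\frac{1}{n+1}\sum_{\mathbf{u}\in\Theta_0}f(\mathbf{u})-f^\star\Big]+\Big(n+\frac{\sqrt n}{2}\Big)\nu\delta .$$
   Context: $C^{1,1}_\nu(\mathbb{R}^n)$ is the class of continuously differentiable functions $f:\mathbb{R}^n\to\mathbb{R}$ with $\|Df(\mathbf{u})-Df(\mathbf{v})\|\le\nu\|\mathbf{u}-\mathbf{v}\|$ for all $\mathbf{u},\mathbf{v}$ (Euclidean norms). Regular simplex: an $n$-dimensional simplex with vertices $\{\mathbf{x}_1,\dots,\mathbf{x}_{n+1}\}\subset\mathbb{R}^n$ is a regular simplex with center $\mathbf{c}\in\mathbb{R}^n$ and radius $\delta>0$ if $\mathbf{c}=\frac1{n+1}\sum_{i=1}^{n+1}\mathbf{x}_i$ and there is an orthogonal matrix $Q\in\mathbb{R}^{(n+1)\times(n+1)}$ with $A=B_\delta Q$, where $A\in\mathbb{R}^{(n+1)\times(n+1)}$ has $i$th row $\begin{bmatrix}0&(\mathbf{x}_i-\mathbf{c})^T\end{bmatrix}$,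 $B=I_{n+1}-\frac{J_{n+1}}{n+1}$ ($J_{n+1}$ the all-ones matrix), and $B_\delta=\sqrt{\frac{n+1}{n}}\,\delta B$. (In particular each vertex is at distance $\delta$ from $\mathbf{c}$ and all edges have equal length.) Basic simplicial search method. Input: $f:\mathbb{R}^n\to\mathbb{R}$, $\mathbf{c}_0\in\mathbb{R}^n$, $\delta>0$. Construct a regular simplex with center $\mathbf{c}_0$ and radius $\delta$, and let $\Theta_0\subset\mathbb{R}^n$ be the set of its $n+1$ vertices. For $k=0,1,\dots$: (i) sort and label the points of $\Theta_k$ as $\{\mathbf{x}_i\}_{i=1}^{n+1}$ such that $f(\mathbf{x}_1)\le f(\mathbf{x}_2)\le\cdots\le f(\mathbf{x}_{n+1})$; (ii) compute the reflection point $\mathbf{x}_0=-\mathbf{x}_{n+1}+\frac2n\sum_{i=1}^n\mathbf{x}_i$; (iii) set $\Theta_{k+1}=(\Theta_k\setminus\{\mathbf{x}_{n+1}\})\cup\{\mathbf{x}_0\}$. *)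

(* Defs.v *)
From mathcomp Require Export all_boot all_order all_algebra.
From mathcomp Require Export all_classical all_reals all_analysis.
Export Order.TTheory GRing.Theory Num.Theory numFieldNormedType.Exports.

#[export] Set Implicit Arguments.
#[export] Unset Strict Implicit.
#[export] Unset Printing Implicit Defensive.

Local Open Scope classical_set_scope.
Local Open Scope ring_scope.

(* The library norm `|u| on 'rV[R]_n is the sup norm, hence this one; the two
   induce the same topology, so differentiability and continuity below may use
   the library structure. *)
Definition enorm (R : realType) (n : nat) (u : 'rV[R]_n) : R :=
  Num.sqrt (\sum_(i < n) u 0 i ^+ 2).

Definition grad (R : realType) (n : nat) (f : 'rV[R]_n -> R) (u : 'rV[R]_n) :
    'rV[R]_n :=
  \row_(i < n) 'D_(delta_mx 0 i) f u.

Definition C11 (R : realType) (n : nat) (nu : R) (f : 'rV[R]_n -> R) : Prop :=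
  [/\ forall u : 'rV[R]_n, differentiable f u,
      continuous (grad f)
    & forall u v : 'rV[R]_n,
        enorm (grad f u - grad f v) <= nu * enorm (u - v)].

Definition affinely_independent (R : realType) (m n : nat)
    (x : 'I_m -> 'rV[R]_n) : Prop :=
  forall a : 'I_m -> R,
    \sum_(i < m) a i = 0 -> \sum_(i < m) a i *: x i = 0 ->
    forall i : 'I_m, a i = 0.

Definition orthogonal_mx (R : realType) (m : nat) (Q : 'M[R]_m) : Prop :=
  Q *m Q^T = 1%:M /\ Q^T *m Q = 1%:M.

(* Row i is [0, (x_i - c)^T]. *)
Definition simplex_mx (R : realType) (n : nat) (x : 'I_n.+1 -> 'rV[R]_n)
    (c : 'rV[R]_n) : 'M[R]_n.+1 :=
  row_mx (0 : 'cV[R]_n.+1) (\matrix_(i < n.+1) (x i - c)).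

(* I - J / (n + 1), with J the all-ones matrix. *)
Definition centering_mx (R : realType) (n : nat) : 'M[R]_n.+1 :=
  1%:M - n.+1%:R^-1 *: const_mx 1.

Definition regular_simplex (R : realType) (n : nat) (x : 'I_n.+1 -> 'rV[R]_n)
    (c : 'rV[R]_n) (delta : R) : Prop :=
  [/\ affinely_independent x,
      c = n.+1%:R^-1 *: \sum_(i < n.+1) x i
    & exists Q : 'M[R]_n.+1, orthogonal_mx Q /\
        simplex_mx x c =
          ((Num.sqrt (n.+1%:R / n%:R) * delta) *: centering_mx R n) *m Q].

(* Points are labelled from 0: x ord_max is the worst vertex (usually written
   x_{n+1}) and the sum ranges over the n others. *)
Definition reflection (R : realType) (n : nat) (x : 'I_n.+1 -> 'rV[R]_n) :
    'rV[R]_n :=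
  - x ord_max + (2 / n%:R) *: \sum_(i < n) x (widen_ord (leqnSn n) i).

Definition sorted_labelling (R : realType) (n : nat) (f : 'rV[R]_n -> R)
    (Theta : set 'rV[R]_n) (x : 'I_n.+1 -> 'rV[R]_n) : Prop :=
  [/\ injective x, Theta = range x
    & forall i j : 'I_n.+1, (i <= j)%N -> f (x i) <= f (x j)].

(* The method leaves the initial regular simplex and the breaking of ties in
   the sort unspecified, so it is a relation on the sequence of simplices. *)
Definition simplicial_search (R : realType) (n : nat) (f : 'rV[R]_n -> R)
    (c0 : 'rV[R]_n) (delta : R) (Theta : nat -> set 'rV[R]_n) : Prop :=
  (exists x : 'I_n.+1 -> 'rV[R]_n,
     regular_simplex x c0 delta /\ Theta 0%N = range x) /\
  (forall k : nat, exists x : 'I_n.+1 -> 'rV[R]_n,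
     sorted_labelling f (Theta k) x /\
     Theta k.+1 = (Theta k `\ x ord_max) `|` [set reflection x]).

Definition center (R : realType) (n : nat) (Theta : set 'rV[R]_n) : 'rV[R]_n :=
  n.+1%:R^-1 *: \sum_(u \in Theta) u.

(* Main.v *)
Require Import Defs.
From mathcomp Require Import ring lra.

(** The average [phi_t] of [f] over the vertices of the [t]-th simplex is the
    Lyapunov function of the method. Let [c] be the center of that simplex and
    [M] the excess of the worst value of [f] over [phi_t]. Two estimates, both
    consequences of the Taylor bound [C11_taylor], are combined.

    - The gradient is controlled by [M] ([grad_mean_le]):
      [|Df c| <= (n / delta) M + (sqrt n / 2) nu delta]. The centered vertices of
      a regular simplex form a tight frame ([tight_frame]), so [|Df c|] can be read
      off the values of the linear form [Df c] at the vertices; up to Taylor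
      remainders these are the centered values of [f], which sum to zero and
      do not exceed [M].
    - Reflecting the worst vertex lowers [f] in proportion to [M]
      ([reflection_drop]):
      [f x_0 - f x_(n+1) <= (2 (n + 1) / n) (nu delta^2 - M)].
      A combination of [f x_0] and the vertex values that kills affine functions
      is bounded by Taylor remainders about the centroid of the face opposite
      to [x_(n+1)].

    Since [phi_(t+1) - phi_t = (f x_0 - f x_(n+1)) / (n + 1)], eliminating [M] gives
    [|Df c| <= n^2 / (2 delta) (phi_t - phi_(t+1)) + (n + sqrt n / 2) nu delta]
    ([search_step]). Summing over [t] telescopes, and [phi_k >= fstar].

    Both estimates need every simplex of the run to be regular of radius [delta].
    Regularity is carried along as a condition on the Gram matrix of the centered
    vertices ([regular_gram]), which relabelling preserves and which a reflection
    preserves because it acts on the centered vertices as an isometry. *)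

Local Open Scope classical_set_scope.
Local Open Scope ring_scope.

(** * Euclidean geometry of row vectors *)

Definition dot (R : realType) (n : nat) (u v : 'rV[R]_n) : R := (u *m v^T) 0 0.

Lemma dotE (R : realType) n (u v : 'rV[R]_n) : dot u v = \sum_i u 0 i * v 0 i.
Proof. by rewrite /dot mxE; apply: eq_bigr => i _; rewrite mxE. Qed.

Lemma dotC (R : realType) n (u v : 'rV[R]_n) : dot u v = dot v u.
Proof. by rewrite !dotE; apply: eq_bigr => i _; rewrite mulrC. Qed.

Lemma dotDl (R : realType) n (u v w : 'rV[R]_n) :
  dot (u + v) w = dot u w + dot v w.
Proof. by rewrite /dot mulmxDl mxE. Qed.

Lemma dotZl (R : realType) n (a : R) (u v : 'rV[R]_n) :
  dot (a *: u) v = a * dot u v.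
Proof. by rewrite /dot -scalemxAl mxE. Qed.

Lemma dotBl (R : realType) n (u v w : 'rV[R]_n) :
  dot (u - v) w = dot u w - dot v w.
Proof. by rewrite -scaleN1r dotDl dotZl mulN1r. Qed.

Lemma dotDr (R : realType) n (u v w : 'rV[R]_n) :
  dot u (v + w) = dot u v + dot u w.
Proof. by rewrite !(dotC u) dotDl. Qed.

Lemma dotZr (R : realType) n (a : R) (u v : 'rV[R]_n) :
  dot u (a *: v) = a * dot u v.
Proof. by rewrite !(dotC u) dotZl. Qed.

Lemma dotBr (R : realType) n (u v w : 'rV[R]_n) :
  dot u (v - w) = dot u v - dot u w.
Proof. by rewrite !(dotC u) dotBl. Qed.

Lemma dot0r (R : realType) n (u : 'rV[R]_n) : dot u 0 = 0.
Proof. by rewrite /dot trmx0 mulmx0 mxE. Qed.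

Lemma dot_sumr (R : realType) n (I : finType) (u : 'rV[R]_n)
    (F : I -> 'rV[R]_n) :
  dot u (\sum_i F i) = \sum_i dot u (F i).
Proof. by rewrite /dot raddf_sum mulmx_sumr summxE. Qed.

Lemma dot_ge0 (R : realType) n (u : 'rV[R]_n) : 0 <= dot u u.
Proof. by rewrite dotE sumr_ge0 // => i _; rewrite -expr2 sqr_ge0. Qed.

Lemma dotvv_eq0 (R : realType) n (u : 'rV[R]_n) : dot u u = 0 -> u = 0.
Proof.
rewrite dotE => /eqP; rewrite psumr_eq0 => [/allP u0|i _]; last first.
  by rewrite -expr2 sqr_ge0.
apply/rowP => i; rewrite mxE; apply/eqP.
by move: (u0 i (mem_index_enum _)); rewrite mulf_eq0 orbb.
Qed.

Lemma enormE (R : realType) n (u : 'rV[R]_n) : enorm u = Num.sqrt (dot u u).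
Proof. by rewrite dotE. Qed.

Lemma sqr_enorm (R : realType) n (u : 'rV[R]_n) : enorm u ^+ 2 = dot u u.
Proof. by rewrite enormE sqr_sqrtr // dot_ge0. Qed.

Lemma enorm_ge0 (R : realType) n (u : 'rV[R]_n) : 0 <= enorm u.
Proof. exact: sqrtr_ge0. Qed.

Lemma enormZ (R : realType) n (a : R) (u : 'rV[R]_n) :
  enorm (a *: u) = `|a| * enorm u.
Proof.
by rewrite !enormE dotZl dotZr mulrA -expr2 sqrtrM ?sqr_ge0 // sqrtr_sqr.
Qed.

Lemma cauchy_schwarz (R : realType) n (u v : 'rV[R]_n) :
  `|dot u v| <= enorm u * enorm v.
Proof.
have [uv0|vv0] := eqVneq (dot v v) 0.
  by rewrite (dotvv_eq0 uv0) dot0r normr0 mulr_ge0 ?enorm_ge0.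
have vv_gt0 : 0 < dot v v by rewrite lt_neqAle eq_sym vv0 dot_ge0.
rewrite -(@ler_pXn2r _ 2) ?nnegrE ?mulr_ge0 ?enorm_ge0 //.
rewrite exprMn !sqr_enorm real_normK ?num_real //.
have := dot_ge0 (dot v v *: u - dot u v *: v).
rewrite !(dotBl, dotBr, dotZl, dotZr) (dotC v u) => h.
rewrite -subr_ge0 -(pmulr_rge0 _ vv_gt0); apply: le_trans h _.
by rewrite le_eqVlt; apply/orP; left; apply/eqP; ring.
Qed.

Lemma enormD (R : realType) n (u v : 'rV[R]_n) :
  enorm (u + v) <= enorm u + enorm v.
Proof.
rewrite -(@ler_pXn2r _ 2) ?nnegrE ?addr_ge0 ?enorm_ge0 //.
rewrite sqrrD !sqr_enorm dotDl !dotDr (dotC v u).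
have := le_trans (ler_norm _) (cauchy_schwarz u v).
lra.
Qed.

(** * First-order Taylor estimate *)

Lemma derive_grad (R : realType) n (f : 'rV[R]_n -> R) (a v : 'rV[R]_n) :
  differentiable f a -> 'D_v f a = dot (grad f a) v.
Proof.
move=> df; rewrite deriveE // [in LHS](row_sum_delta v) linear_sum dotE.
by apply: eq_bigr => i _; rewrite linearZ mxE deriveE //= mulrC.
Qed.

(** The difference quotients of [s |-> f (u + s v)] at [t] are literally those of
    the directional derivative of [f] at [u + t v]. *)
Lemma is_derive_line (R : realType) n (f : 'rV[R]_n -> R) (u v : 'rV[R]_n) t :
  differentiable f (u + t *: v) ->
  is_derive t 1 (fun s : R => f (u + s *: v)) (dot (grad f (u + t *: v)) v).
Proof.
move=> df; have dfv : derivable f (u + t *: v) v by exact: diff_derivable.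
have E : (fun h : R => h^-1 *: (((fun s : R => f (u + s *: v)) \o shift t)
            (h *: (1 : R)) - f (u + t *: v))) =
         (fun h : R => h^-1 *: ((f \o shift (u + t *: v)) (h *: v)
            - f (u + t *: v))).
  apply/funext => h /=; congr (_ *: (f _ - _)).
  by rewrite [h *: 1]mulr1 scalerDl addrCA.
split; first by rewrite /derivable E.
by rewrite -derive_grad // /derive E.
Qed.

(** The mean value theorem is applied to [h] with its first-order part and the
    parabola [L t^2 / 2] removed, a function with nonpositive derivative; doing
    this for both signs of [h] yields the absolute value without integration. *)
Lemma taylor1 (R : realType) (h dh : R -> R) (L : R) :
  (forall t : R, is_derive t 1 h (dh t)) ->
  (forall t : R, 0 <= t -> `|dh t - dh 0| <= L * t) ->
  `|h 1 - h 0 - dh 0| <= L / 2.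
Proof.
move=> hd hL.
have key (s : R) : `|s| = 1 -> s * (h 1 - h 0 - dh 0) <= L / 2.
  move=> s1.
  pose p (t : R) := s * h t - (s * dh 0) * t - (L / 2) * (t * t).
  pose dp (t : R) := s * dh t - s * dh 0 - L * t.
  have pd (t : R) : is_derive t 1 p (dp t).
    rewrite /p; have := hd t => ?; apply: is_derive_eq.
    by rewrite /dp /GRing.scale /=; field.
  have [c /andP[c0 c1]] : exists2 c : R, c \in `]0, 1[ &
      p 1 - p 0 = dp c * (1 - 0).
    apply: (@MVT _ p dp) => //.
    apply: derivable_within_continuous => y _.
    exact: (@ex_derive _ _ _ _ _ _ _ (pd y)).
  have : dp c <= 0.
    rewrite /dp -mulrBr subr_le0 (le_trans (ler_norm _)) // normrM s1 mul1r.
    by rewrite hL // ltW.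
  rewrite /p; lra.
have := key 1 (normr1 _); have := key (-1) (normrN1 _).
rewrite ler_norml; lra.
Qed.

(** The descent lemma: [taylor1] along the segment from [u] to [v]. *)
Lemma C11_taylor (R : realType) n (nu : R) (f : 'rV[R]_n -> R)
    (hf : C11 nu f) (u v : 'rV[R]_n) :
  `|f v - f u - dot (grad f u) (v - u)| <= nu / 2 * dot (v - u) (v - u).
Proof.
case: hf => df _ lip; set d := v - u.
have := @taylor1 _ (fun s => f (u + s *: d)) (fun s => dot (grad f (u + s *: d)) d)
  (nu * dot d d).
rewrite !scale1r !scale0r !addr0 /d (subrKC u v) -/d mulrAC; apply.
- by move=> t; exact: is_derive_line.
- move=> t t0; rewrite -dotBl (le_trans (cauchy_schwarz _ _)) //.
  rewrite -sqr_enorm expr2 mulrA mulrAC ler_wpM2r ?enorm_ge0 //.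
  apply: le_trans (lip _ _) _.
  by rewrite addrC addKr enormZ ger0_norm // (mulrC t) mulrA.
Qed.

(** * Regular simplices through their Gram matrix *)

Definition mean (R : realType) n (x : 'I_n.+1 -> 'rV[R]_n) : 'rV[R]_n :=
  n.+1%:R^-1 *: \sum_i x i.

(** The Gram matrix of the vertices about their centroid is the only feature of
    a regular simplex that the analysis uses, and, unlike the orthogonal factor
    [Q], it is visibly invariant under relabelling and isometries. *)
Definition regular_gram (R : realType) n (delta : R) (x : 'I_n.+1 -> 'rV[R]_n) :=
  forall i j, dot (x i - mean x) (x j - mean x) =
    n.+1%:R / n%:R * delta ^+ 2 * ((i == j)%:R - n.+1%:R^-1).

Lemma sum_mean (R : realType) n (x : 'I_n.+1 -> 'rV[R]_n) :
  \sum_i x i = n.+1%:R *: mean x.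
Proof. by rewrite scalerA divff ?scale1r ?pnatr_eq0. Qed.

Lemma sum_dev (R : realType) n (x : 'I_n.+1 -> 'rV[R]_n) :
  \sum_i (x i - mean x) = 0.
Proof.
by rewrite sumrB sum_mean sumr_const card_ord -[in X in _ - X]scaler_nat subrr.
Qed.

(** The centering matrix is an orthogonal projection, hence [B B^T = B]. *)
Lemma centering_idem (R : realType) n :
  centering_mx R n *m (centering_mx R n)^T = centering_mx R n.
Proof.
pose J : 'M[R]_n.+1 := const_mx 1.
have JJ : J *m J = n.+1%:R *: J.
  apply/matrixP => i j; rewrite !mxE (eq_bigr (fun=> 1)) => [|k _].
    by rewrite sumr_const card_ord mulr1.
  by rewrite !mxE mulr1.
have Jt : J^T = J by exact: trmx_const.
rewrite /centering_mx -/J [(_ - _)^T]linearB /= trmx1.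
have -> : (n.+1%:R^-1 *: J)^T = n.+1%:R^-1 *: J by rewrite linearZ /= Jt.
rewrite mulmxBl !mulmxBr !mul1mx mulmx1 -scalemxAl -scalemxAr JJ !scalerA.
by rewrite -mulrA mulVf ?pnatr_eq0 // mulr1 subrr subr0.
Qed.

(** [A A^T] is the Gram matrix of the centered vertices, and the orthogonal factor
    cancels: [B_delta Q Q^T B_delta^T] is a multiple of [B]. *)
Lemma regular_simplex_regular_gram (R : realType) n (x : 'I_n.+1 -> 'rV[R]_n)
    (c : 'rV[R]_n) (delta : R) :
  regular_simplex x c delta -> regular_gram delta x.
Proof.
case=> _ c_mean [Q [[QQ _] xQ]] i j; rewrite /mean -c_mean.
pose A : 'M[R]_(n.+1, 1 + n) := row_mx 0 (\matrix_(i < n.+1) (x i - c)).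
have /matrixP/(_ i j) :
    A *m A^T = (n.+1%:R / n%:R * delta ^+ 2) *: centering_mx R n.
  change (simplex_mx x c *m (simplex_mx x c)^T =
    (n.+1%:R / n%:R * delta ^+ 2) *: centering_mx R n).
  rewrite xQ trmx_mul mulmxA -(mulmxA _ Q) QQ mulmx1 linearZ /=.
  rewrite -scalemxAl -scalemxAr centering_idem scalerA -expr2 exprMn.
  by rewrite sqr_sqrtr // divr_ge0.
rewrite /A tr_row_mx mul_row_col mul0mx add0r !mxE mulr1 => <-.
by rewrite dotE; apply: eq_bigr => k _; rewrite !mxE.
Qed.

Lemma natr_succ_neq0 (R : realType) n : n%:R + 1 != 0 :> R.
Proof. by rewrite natr1 pnatr_eq0. Qed.

Lemma regular_gram_norm (R : realType) n (x : 'I_n.+1 -> 'rV[R]_n) (delta : R) i :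
  (0 < n)%N -> regular_gram delta x ->
  dot (x i - mean x) (x i - mean x) = delta ^+ 2.
Proof.
move=> n_gt0 ->; rewrite eqxx mulr1n.
have N0 : n%:R != 0 :> R by rewrite pnatr_eq0 -lt0n.
by rewrite -[n.+1%:R]natr1; field;
    rewrite natr_succ_neq0 N0.
Qed.

(** With [Y] the matrix of centered vertices, [Y Y^T = s (I - J / (n+1))].
    Prepending a constant column to [Y] supplies the missing [J]: the resulting
    square matrix [M] has [M M^T = s I], so also [M^T M = s I], whose lower right
    block says [Y^T Y = s I]. *)
Lemma tight_frame (R : realType) n (x : 'I_n.+1 -> 'rV[R]_n) (delta : R)
    (v : 'rV[R]_n) :
  (0 < n)%N -> 0 < delta -> regular_gram delta x ->
  \sum_i dot v (x i - mean x) ^+ 2 = n.+1%:R / n%:R * delta ^+ 2 * dot v v.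
Proof.
move=> n_gt0 d_gt0 hx; set s := _ / _ * _.
have s_gt0 : 0 < s by rewrite mulr_gt0 ?divr_gt0 ?ltr0n ?exprn_gt0.
pose Y : 'M[R]_(n.+1, n) := \matrix_i (x i - mean x).
have rowY i : row i Y = x i - mean x by rewrite rowK.
pose a : R := Num.sqrt (s / n.+1%:R).
pose M : 'M[R]_(n.+1, 1 + n) := row_mx (const_mx a) Y.
have MMt : M *m (s^-1 *: M^T) = 1%:M.
  apply/matrixP => i j; rewrite -scalemxAr /M tr_row_mx mul_row_col trmx_const.
  pose u : 'cV[R]_n.+1 := const_mx a; pose w : 'rV[R]_n.+1 := const_mx a.
  have -> : u *m w = const_mx (s / n.+1%:R).
    apply/matrixP => k l; rewrite !mxE big_ord1 !mxE -expr2 sqr_sqrtr //.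
    by rewrite divr_ge0 ?ltW // ltr0n.
  have -> : Y *m Y^T = \matrix_(k, l) (s * ((k == l)%:R - n.+1%:R^-1)).
    apply/matrixP => k l; rewrite [RHS]mxE -hx dotE mxE.
    by apply: eq_bigr => m _; rewrite !mxE.
  by rewrite !mxE mulrBr addrC subrK mulKf // lt0r_neq0.
have MtM : Y^T *m Y = s%:M.
  have : M^T *m M = s%:M.
    have := mulmx1C MMt; rewrite -scalemxAl => /(congr1 ( *:%R s)).
    by rewrite scalerA divff ?lt0r_neq0 // scale1r scale_scalar_mx mulr1.
  rewrite /M tr_row_mx mul_col_row scalar_mx_block.
  by case/eq_block_mx.
have -> : s * dot v v = dot (v *m Y^T) (v *m Y^T).
  rewrite /dot trmx_mul trmxK mulmxA -(mulmxA v) MtM mul_mx_scalar -scalemxAl.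
  by rewrite [RHS]mxE.
rewrite dotE; apply: eq_bigr => i _; rewrite -rowY dotE mxE expr2.
by congr (_ * _); apply: eq_bigr => k _; rewrite !mxE.
Qed.

(** An upper bound [M] on numbers of sum zero forces the lower bound [- n M]; then
    [(M - a_i) (a_i + n M) >= 0], and in the sum over [i] the linear terms vanish.
    Applied to the values of a linear form at the vertices, and combined with
    [tight_frame], this says that a regular
    simplex of radius [delta] contains the ball of radius [delta / n]. *)
Lemma sqr_sum_le_max (R : realType) n (a : 'I_n.+1 -> R) (M : R) :
  \sum_i a i = 0 -> (forall i, a i <= M) ->
  \sum_i a i ^+ 2 <= n%:R * n.+1%:R * M ^+ 2.
Proof.
move=> a0 aM.
have a_ge i : - (n%:R * M) <= a i.
  rewrite -subr_ge0 opprK.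
  have : \sum_(j | j != i) a j <= \sum_(j < n.+1 | j != i) M.
    by apply: ler_sum => j _; exact: aM.
  move: a0; rewrite (bigD1 i) //= => a0.
  rewrite sumr_const cardC1 card_ord /= -(mulr_natl M); lra.
have : 0 <= \sum_i (M - a i) * (a i + n%:R * M).
  apply: sumr_ge0 => i _; rewrite mulr_ge0 ?subr_ge0 //.
  by have := a_ge i; lra.
rewrite (eq_bigr (fun i => (n%:R * M ^+ 2 + (M - n%:R * M) * a i) - a i ^+ 2));
  last by move=> i _; ring.
rewrite sumrB big_split /= -[\sum_i (_ - _) * a i]mulr_sumr a0 mulr0 addr0.
rewrite sumr_const card_ord.
by rewrite subr_ge0 -[_ *+ n.+1]mulr_natr mulrAC.
Qed.

Lemma variance_le (R : realType) n (e : 'I_n.+1 -> R) :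
  \sum_i (e i - n.+1%:R^-1 * \sum_j e j) ^+ 2 <= \sum_i e i ^+ 2.
Proof.
set m := _ * _.
have em : \sum_j e j = n.+1%:R * m by rewrite mulVKf ?pnatr_eq0.
rewrite (eq_bigr (fun i => e i ^+ 2 + (m ^+ 2 - 2 * m * e i))); last first.
  by move=> i _; ring.
rewrite big_split /= sumrB -[\sum_i 2 * m * e i]mulr_sumr em sumr_const.
rewrite card_ord -[_ *+ n.+1]mulr_natl.
have : 0 <= n.+1%:R * m ^+ 2 by rewrite mulr_ge0 ?ler0n ?sqr_ge0.
lra.
Qed.

(** The simplex gradient estimate. On the vertices, the linear form given by the
    gradient at the centroid differs from the centered values of [f] by the
    centered Taylor remainders, each remainder being at most [nu delta^2 / 2].
    By [tight_frame] the Euclidean length of that linear form, as a vector of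
    [n + 1] numbers, is a multiple of the norm of the gradient, so Minkowski's
    inequality separates the two contributions: the first is controlled by its
    maximum through [sqr_sum_le_max], the second yields the [sqrt n / 2] term. *)
Lemma grad_mean_le (R : realType) n (nu : R) (f : 'rV[R]_n -> R)
    (x : 'I_n.+1 -> 'rV[R]_n) (delta M : R) :
  (0 < n)%N -> 0 < delta -> 0 < nu -> C11 nu f -> regular_gram delta x ->
  (forall i, f (x i) - n.+1%:R^-1 * (\sum_j f (x j)) <= M) ->
  enorm (grad f (mean x)) <= n%:R / delta * M + Num.sqrt n%:R / 2 * nu * delta.
Proof.
move=> n_gt0 d_gt0 nu_gt0 hf hx; set phi := _ * _ => aM.
set g := grad f _.
pose a : 'rV[R]_n.+1 := \row_i (f (x i) - phi).
pose b : 'rV[R]_n.+1 := \row_i dot g (x i - mean x).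
pose e i := f (x i) - f (mean x) - dot g (x i - mean x).
have n1 : n.+1%:R != 0 :> R by rewrite pnatr_eq0.
have N0 : n%:R != 0 :> R by rewrite pnatr_eq0 -lt0n.
have sumf : \sum_j f (x j) = n.+1%:R * phi by rewrite mulVKf.
have suma : \sum_i (f (x i) - phi) = 0.
  by rewrite sumrB sumf sumr_const card_ord -[phi *+ _]mulr_natl subrr.
have sumb : \sum_i dot g (x i - mean x) = 0 by rewrite -dot_sumr sum_dev dot0r.
have M_ge0 : 0 <= M.
  rewrite -(pmulr_rge0 _ (ltr0Sn R n)) mulr_natl.
  have : \sum_(i < n.+1) (f (x i) - phi) <= \sum_(i < n.+1) M by exact: ler_sum.
  by rewrite suma sumr_const card_ord.
have dist i := regular_gram_norm i n_gt0 hx.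
(* The gradient term averages to zero over the centered vertices. *)
have me : n.+1%:R^-1 * \sum_i e i = phi - f (mean x).
  rewrite /e sumrB sumb subr0 sumrB sumf sumr_const card_ord -[f _ *+ _]mulr_natl.
  by rewrite -mulrBr mulKf.
have e_le i : e i ^+ 2 <= (nu / 2 * delta ^+ 2) ^+ 2.
  have h := C11_taylor hf (mean x) (x i); rewrite dist in h.
  rewrite -(real_normK (num_real (e i))) ler_pXn2r ?nnegrE //.
  exact: le_trans (normr_ge0 _) h.
have hb : enorm b = Num.sqrt n.+1%:R / Num.sqrt n%:R * delta * enorm g.
  rewrite !enormE dotE (eq_bigr (fun i => dot g (x i - mean x) ^+ 2)); last first.
    by move=> i _; rewrite !mxE expr2.
  rewrite (tight_frame _ n_gt0 d_gt0 hx).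
  set s := n.+1%:R / n%:R; have s_ge0 : 0 <= s by rewrite divr_ge0.
  rewrite (sqrtrM _ (mulr_ge0 s_ge0 (sqr_ge0 delta))) (sqrtrM _ s_ge0).
  by rewrite sqrtr_sqr gtr0_norm // /s sqrtrM // sqrtrV.
have ha : enorm a <= Num.sqrt n%:R * Num.sqrt n.+1%:R * M.
  rewrite enormE -[X in _ * X]ger0_norm // -sqrtr_sqr -!sqrtrM ?mulr_ge0 //.
  rewrite ler_sqrt ?mulr_ge0 ?sqr_ge0 // dotE.
  rewrite (eq_bigr (fun i => (f (x i) - phi) ^+ 2)); last first.
    by move=> i _; rewrite !mxE expr2.
  exact: sqr_sum_le_max.
have hr : enorm (b - a) <= Num.sqrt n.+1%:R * (nu / 2 * delta ^+ 2).
  have c_ge0 : 0 <= nu / 2 * delta ^+ 2.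
    by rewrite mulr_ge0 ?divr_ge0 ?sqr_ge0 // ltW.
  rewrite enormE -[X in _ * X]ger0_norm // -sqrtr_sqr -!sqrtrM //.
  rewrite ler_sqrt; last by rewrite mulr_ge0 ?sqr_ge0.
  rewrite dotE.
  rewrite (eq_bigr (fun i => (e i - n.+1%:R^-1 * \sum_j e j) ^+ 2)); last first.
    by move=> i _; rewrite me !mxE /e; ring.
  apply: le_trans (variance_le _) _.
  have : \sum_i e i ^+ 2 <= \sum_(i < n.+1) (nu / 2 * delta ^+ 2) ^+ 2.
    exact: ler_sum.
  by rewrite sumr_const card_ord -[_ ^+ 2 *+ n.+1]mulr_natl.
have := le_trans (enormD (b - a) a) (lerD hr ha).
rewrite subrK hb.
set p := Num.sqrt n%:R; set q := Num.sqrt n.+1%:R.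
have p_gt0 : 0 < p by rewrite sqrtr_gt0 ltr0n.
have q_gt0 : 0 < q by rewrite sqrtr_gt0 ltr0n.
have pp : n%:R = p * p by rewrite -expr2 sqr_sqrtr.
rewrite pp => h.
rewrite -(ler_pM2l (_ : 0 < q / p * delta)) ?mulr_gt0 ?invr_gt0 //.
apply: le_trans h _; rewrite le_eqVlt; apply/orP; left; apply/eqP.
by field; rewrite ?gt_eqF.
Qed.

(** * Reflection of the worst vertex *)

(** The centroid form of the reflection: the opposite face averages to
    [mean x - (x ord_max - mean x) / n]. *)
Lemma reflectionE (R : realType) n (x : 'I_n.+1 -> 'rV[R]_n) :
  (0 < n)%N ->
  reflection x =
  x ord_max - (2 * n.+1%:R / n%:R) *: (x ord_max - mean x).
Proof.
move=> n_gt0; have N0 : n%:R != 0 :> R by rewrite pnatr_eq0 -lt0n.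
have := sum_mean x; rewrite big_ord_recr /= => /(canRL (addrK _)) sumx.
rewrite /reflection sumx; apply/rowP => i; rewrite !mxE -[n.+1%:R]natr1.
by field; rewrite natr_succ_neq0 N0.
Qed.

Definition reflect (R : realType) n (x : 'I_n.+1 -> 'rV[R]_n) (i : 'I_n.+1) :=
  if i == ord_max then reflection x else x i.

Lemma sum_reflect (R : realType) n (V : zmodType) (f : 'rV[R]_n -> V)
    (x : 'I_n.+1 -> 'rV[R]_n) :
  \sum_i f (reflect x i) = \sum_i f (x i) + (f (reflection x) - f (x ord_max)).
Proof.
rewrite -[LHS](subrK (\sum_i f (x i))) addrC -sumrB; congr (_ + _).
rewrite (bigD1 ord_max) //= /reflect eqxx big1 ?addr0 // => i /negPf ->.
by rewrite subrr.
Qed.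

Lemma mean_reflect (R : realType) n (x : 'I_n.+1 -> 'rV[R]_n) :
  (0 < n)%N ->
  mean (reflect x) = mean x - (2 / n%:R) *: (x ord_max - mean x).
Proof.
move=> n_gt0; have N0 : n%:R != 0 :> R by rewrite pnatr_eq0 -lt0n.
have n1 : n.+1%:R != 0 :> R by rewrite pnatr_eq0.
have := sum_reflect id x.
rewrite !sum_mean reflectionE // => h.
apply: (scalerI n1); rewrite h.
by apply/rowP => i; rewrite !mxE -[n.+1%:R]natr1; field;
    rewrite natr_succ_neq0 N0.
Qed.

(** Relative to the centroids, reflecting a vertex is the Householder reflection in
    the direction [y] of that vertex, of squared length [delta ^+ 2]: it moves the
    centroid just enough that the other vertices are reflected too. *)
Lemma reflect_dev (R : realType) n (x : 'I_n.+1 -> 'rV[R]_n) (delta : R) i :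
  (0 < n)%N -> 0 < delta -> regular_gram delta x ->
  let y := x ord_max - mean x in
  reflect x i - mean (reflect x) =
  (x i - mean x) - (2 * dot (x i - mean x) y / delta ^+ 2) *: y.
Proof.
move=> n_gt0 d_gt0 hx /=; set y := x ord_max - mean x.
have N0 : n%:R != 0 :> R by rewrite pnatr_eq0 -lt0n.
have d0 := lt0r_neq0 d_gt0.
rewrite mean_reflect // /reflect; case: (eqVneq i ord_max) => [->|i_max].
  rewrite (regular_gram_norm _ n_gt0 hx) reflectionE // -/y mulfK ?expf_neq0 //.
  by apply/rowP => k; rewrite !mxE -[n.+1%:R]natr1; field;
    rewrite natr_succ_neq0 N0.
rewrite hx (negPf i_max) sub0r opprB addrCA addrC -/y; congr (_ + _).
rewrite -scaleNr; congr (_ *: _); rewrite -[n.+1%:R]natr1.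
by field; rewrite natr_succ_neq0 N0 d0.
Qed.

(** Householder reflections are isometries. *)
Lemma regular_gram_reflect (R : realType) n (x : 'I_n.+1 -> 'rV[R]_n) (delta : R) :
  (0 < n)%N -> 0 < delta -> regular_gram delta x -> regular_gram delta (reflect x).
Proof.
move=> n_gt0 d_gt0 hx i j; rewrite !(reflect_dev _ n_gt0 d_gt0 hx) -hx.
have := regular_gram_norm ord_max n_gt0 hx.
move: (x i - _) (x j - _) (x ord_max - _) => u v y yy.
rewrite !(dotBl, dotBr, dotZl, dotZr) (dotC y v) yy.
by field; rewrite lt0r_neq0.
Qed.

(** Two equal vertices would make a diagonal and an off-diagonal entry coincide. *)
Lemma regular_gram_inj (R : realType) n (x : 'I_n.+1 -> 'rV[R]_n) (delta : R) :
  (0 < n)%N -> 0 < delta -> regular_gram delta x -> injective x.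
Proof.
move=> n_gt0 d_gt0 hx i j xij; apply: contraTeq isT => ij.
have d0 := lt0r_neq0 d_gt0.
have N0 : n%:R != 0 :> R by rewrite pnatr_eq0 -lt0n.
have := hx i j; rewrite -xij hx eqxx (negPf ij).
have k0 : n.+1%:R / n%:R * delta ^+ 2 != 0.
  by rewrite !mulf_neq0 ?invr_neq0 ?pnatr_eq0 ?expf_neq0 // -lt0n.
by move=> /(mulfI k0)/addIr/eqP; rewrite oner_eq0.
Qed.

(** The combination
    [f (reflection x) + f (x ord_max) - (2 / n) \sum_(i < n) f (x i)] vanishes for
    affine [f], so Taylor remainders alone bound it, here by
    [2 (n + 1) / n * nu * delta ^+ 2]. The expansion point [m], the centroid of the
    face opposite to the worst vertex, is the barycenter of all these points for
    the absolute values of the weights, hence minimizes the remainder bound. *)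
Lemma reflection_drop (R : realType) n (nu : R) (f : 'rV[R]_n -> R)
    (x : 'I_n.+1 -> 'rV[R]_n) (delta : R) :
  (0 < n)%N -> C11 nu f -> regular_gram delta x ->
  let M := f (x ord_max) - n.+1%:R^-1 * (\sum_j f (x j)) in
  f (reflection x) - f (x ord_max) <=
  2 * n.+1%:R / n%:R * (nu * delta ^+ 2 - M).
Proof.
move=> n_gt0 hf hx /=; set phi := n.+1%:R^-1 * _.
have N0 : n%:R != 0 :> R by rewrite pnatr_eq0 -lt0n.
have n1 : n.+1%:R != 0 :> R by rewrite pnatr_eq0.
set y := x ord_max - mean x; set m := mean x - n%:R^-1 *: y.
have yy : dot y y = delta ^+ 2 by exact: regular_gram_norm.
have upper u := le_trans (ler_norm _) (C11_taylor hf m u).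
have lower u : f m + dot (grad f m) (u - m) - nu / 2 * dot (u - m) (u - m) <= f u.
  by have := C11_taylor hf m u; rewrite ler_norml; lra.
pose z i := x (widen_ord (leqnSn n) i).
have sumz : \sum_(i < n) f (z i) = n.+1%:R * phi - f (x ord_max).
  by rewrite /phi mulVKf // big_ord_recr /= addrK.
have sumzm : \sum_(i < n) (z i - m) = 0.
  have := sum_mean x; rewrite big_ord_recr /= => /(canRL (addrK _)) sumx.
  rewrite sumrB sumx sumr_const card_ord -[m *+ _]scaler_nat.
  by apply/rowP => i; rewrite !mxE -[n.+1%:R]natr1; field;
    rewrite natr_succ_neq0 N0.
have zz i : dot (z i - m) (z i - m) = delta ^+ 2 * (1 - (n%:R ^+ 2)^-1).
  have -> : z i - m = (z i - mean x) + n%:R^-1 *: y by rewrite /m opprB addrA addrAC.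
  have uu := regular_gram_norm (widen_ord (leqnSn n) i) n_gt0 hx.
  have := hx (widen_ord (leqnSn n) i) ord_max.
  have -> : (widen_ord (leqnSn n) i == ord_max) = false.
    by apply/negbTE; rewrite neq_ltn /= ltn_ord.
  rewrite mulr0n sub0r -/(z i) -/y in uu * => uy.
  move: (z i - mean x) (y) uu uy yy => u w uu uw ww.
  rewrite !(dotDl, dotDr, dotZl, dotZr) (dotC w) ww uu uw.
  by rewrite -[n.+1%:R]natr1; field;
    rewrite natr_succ_neq0 N0.
set e := nu / 2 * (delta ^+ 2 * (1 - (n%:R ^+ 2)^-1)).
have hz : \sum_(i < n) (f m + dot (grad f m) (z i - m) - e) <= \sum_(i < n) f (z i).
  by apply: ler_sum => i _; rewrite /e -(zz i); exact: lower.
move: hz; rewrite sumrB big_split /= -dot_sumr sumzm dot0r addr0.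
rewrite !sumr_const card_ord -[f m *+ n]mulr_natl -[e *+ n]mulr_natl sumz => hz.
(* The worst vertex and its reflection are symmetric about [m]. *)
have w_m : x ord_max - m = (n.+1%:R / n%:R) *: y.
  by apply/rowP => i; rewrite !mxE -[n.+1%:R]natr1; field;
    rewrite natr_succ_neq0 N0.
have r_m : reflection x - m = - (n.+1%:R / n%:R) *: y.
  rewrite reflectionE //; apply/rowP => i; rewrite !mxE -[n.+1%:R]natr1.
  by field; rewrite natr_succ_neq0 N0.
have := upper (reflection x); have := upper (x ord_max).
rewrite w_m r_m !(dotZl, dotZr) yy -[n.+1%:R]natr1.
rewrite -[n.+1%:R]natr1 in hz.
set g := dot _ _ => upper_max upper_refl.
have N_gt0 : 0 < n%:R :> R by rewrite ltr0n.
(* The average of the lower bounds over the opposite face. *)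
have lower_m : f m <= e + n%:R^-1 * ((n%:R + 1) * phi - f (x ord_max)).
  by rewrite -lerBlDl ler_pdivlMl // mulrBr.
have -> : 2 * (n%:R + 1) / n%:R * (nu * delta ^+ 2 - (f (x ord_max) - phi)) =
    2 * (e + n%:R^-1 * ((n%:R + 1) * phi - f (x ord_max))) +
    nu / 2 * ((n%:R + 1) / n%:R * ((n%:R + 1) / n%:R * delta ^+ 2)) +
    nu / 2 * (- ((n%:R + 1) / n%:R) * (- ((n%:R + 1) / n%:R) * delta ^+ 2)) -
    2 * f (x ord_max).
  by rewrite /e; field.
lra.
Qed.

(** * Simplices as sets of points *)

Lemma fsbig_range (V : nmodType) (I : finType) (T : choiceType) (x : I -> T)
    (F : T -> V) :
  injective x -> \sum_(u \in range x) F u = \sum_i F (x i).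
Proof.
move=> x_inj; rewrite fsbig_image; last by move=> i j _ _; exact: x_inj.
rewrite [RHS](fsbig_seq _ _ (index_enum_uniq I)).
by apply: eq_fsbigl; apply/seteqP; split=> i //= _; exact: mem_index_enum.
Qed.

(** Two labellings of the same finite set differ by a relabelling of the indices. *)
Lemma range_perm (I : finType) (T : Type) (x z : I -> T) :
  injective z -> range z = range x ->
  exists2 s : I -> I, injective s & forall i, z i = x (s i).
Proof.
move=> z_inj zx.
have /choice[s zs] : forall i, exists j, z i = x j.
  move=> i; have : range x (z i) by rewrite -zx; exists i.
  by case=> j _ <-; exists j.
by exists s => // i j sij; apply: z_inj; rewrite !zs sij.
Qed.

Lemma mean_perm (R : realType) n (x z : 'I_n.+1 -> 'rV[R]_n)
    (s : 'I_n.+1 -> 'I_n.+1) :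
  injective s -> (forall i, z i = x (s i)) -> mean z = mean x.
Proof.
move=> s_inj zs; rewrite /mean; congr (_ *: _); rewrite [RHS](reindex_inj s_inj).
by apply: eq_bigr => i _; rewrite zs.
Qed.

Lemma regular_gram_perm (R : realType) n (x z : 'I_n.+1 -> 'rV[R]_n)
    (s : 'I_n.+1 -> 'I_n.+1) (delta : R) :
  injective s -> (forall i, z i = x (s i)) ->
  regular_gram delta x -> regular_gram delta z.
Proof.
by move=> s_inj zs hx i j; rewrite (mean_perm s_inj zs) !zs hx (inj_eq s_inj).
Qed.

Lemma range_reflect (R : realType) n (x : 'I_n.+1 -> 'rV[R]_n) :
  injective x ->
  (range x `\ x ord_max) `|` [set reflection x] = range (reflect x).
Proof.
move=> x_inj; apply/seteqP; split=> u /=.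
- case=> [[[i _ <-] ne]|->].
    by exists i; rewrite // /reflect; case: eqP => // i_max; rewrite i_max in ne.
  by exists ord_max; rewrite // /reflect eqxx.
- case=> i _ <-; rewrite /reflect; case: (eqVneq i ord_max) => [_|ne].
    by right.
  left; split; first by exists i.
  by move=> /x_inj i_max; rewrite i_max eqxx in ne.
Qed.

(** * The search *)

Definition set_avg (R : realType) n (f : 'rV[R]_n -> R) (Theta : set 'rV[R]_n) : R :=
  n.+1%:R^-1 * \sum_(u \in Theta) f u.

(** Every simplex of the run stays regular of the same radius: sorting only
    relabels the vertices and each update is a reflection. *)
Lemma search_regular_gram (R : realType) n (f : 'rV[R]_n -> R) (c0 : 'rV[R]_n)
    (delta : R) (Theta : nat -> set 'rV[R]_n) (k : nat) :
  (0 < n)%N -> 0 < delta -> simplicial_search f c0 delta Theta ->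
  exists x, [/\ regular_gram delta x, sorted_labelling f (Theta k) x
              & Theta k.+1 = range (reflect x)].
Proof.
move=> n_gt0 d_gt0 [[x0 [x0_reg Theta0]] step].
have next j z : regular_gram delta z -> Theta j = range z ->
    exists x, [/\ regular_gram delta x, sorted_labelling f (Theta j) x
                & Theta j.+1 = range (reflect x)].
  move=> hz Thetaj; have [x [x_lab Theta'j]] := step j.
  exists x; case: (x_lab) => x_inj Thetax _.
  have [s s_inj xs] := range_perm x_inj (etrans (esym Thetax) Thetaj).
  split=> //; first exact: regular_gram_perm xs hz.
  by rewrite Theta'j Thetax range_reflect.
elim: k => [|k [x [hx _ Theta']]]; apply: next.
- exact: regular_simplex_regular_gram x0_reg.
- exact: Theta0.
- exact: regular_gram_reflect hx.
- exact: Theta'.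
Qed.

(** The replaced vertex changes the average of [f] by
    [(f (reflection x) - f (x ord_max)) / (n + 1)]. Bounding the gradient by the gap
    [M] between the worst value and the average, then [M] by the decrease of the
    average, gives an inequality that telescopes. *)
Lemma search_step (R : realType) n (nu : R) (f : 'rV[R]_n -> R) (delta : R)
    (x : 'I_n.+1 -> 'rV[R]_n) (Theta : set 'rV[R]_n) :
  (0 < n)%N -> 0 < delta -> 0 < nu -> C11 nu f -> regular_gram delta x ->
  sorted_labelling f Theta x ->
  enorm (grad f (center Theta)) <=
  n%:R ^+ 2 / (2 * delta) * (set_avg f Theta - set_avg f (range (reflect x))) +
  (n%:R + Num.sqrt n%:R / 2) * nu * delta.
Proof.
move=> n_gt0 d_gt0 nu_gt0 hf hx [x_inj -> x_sorted].
have r_inj := regular_gram_inj n_gt0 d_gt0 (regular_gram_reflect n_gt0 d_gt0 hx).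
rewrite /center /set_avg !fsbig_range // sum_reflect -/(mean x).
have := reflection_drop n_gt0 hf hx; set phi := n.+1%:R^-1 * _.
set M := f (x ord_max) - phi => drop.
have := @grad_mean_le _ _ nu f x delta M n_gt0 d_gt0 nu_gt0 hf hx.
rewrite -/phi => /(_ _)/le_trans; apply.
  by move=> i; rewrite lerB // x_sorted // -ltnS ltn_ord.
have N_gt0 : 0 < n%:R :> R by rewrite ltr0n.
rewrite [n.+1%:R^-1 * (_ + _)]mulrDr -/phi opprD addrA subrr sub0r.
move: drop; set F := f (reflection x) - _ => drop.
have k_ge0 : 0 <= n%:R ^+ 2 / (2 * delta) / n.+1%:R.
  by rewrite ?divr_ge0 ?exprn_ge0 ?mulr_ge0 // ltW.
pose B := 2 * n.+1%:R / n%:R * (nu * delta ^+ 2 - M).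
have {}drop : F <= B by exact: drop.
have -> : n%:R / delta * M = n%:R * nu * delta -
    n%:R ^+ 2 / (2 * delta) / n.+1%:R * B.
  by rewrite /B; field; rewrite nat1r (lt0r_neq0 N_gt0) (lt0r_neq0 d_gt0) pnatr_eq0.
rewrite mulrN [n%:R ^+ 2 / (2 * delta) * (_ * F)]mulrA.
have := ler_wpM2l k_ge0 drop.
move: (_ / n.+1%:R * F) (_ / n.+1%:R * B) => A A'; lra.
Qed.

Theorem theorem7p7 (R : realType) (n : nat) (hn : (0 < n)%N)
  (nu : R) (hnu : 0 < nu) (f : 'rV[R]_n -> R) (hf : C11 nu f)
  (fstar : R) (hfstar : forall u : 'rV[R]_n, fstar <= f u)
  (c0 : 'rV[R]_n) (delta : R) (hdelta : 0 < delta)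
  (Theta : nat -> set 'rV[R]_n) (hTheta : simplicial_search f c0 delta Theta)
  (k : nat) (hk : (1 <= k)%N) :
  k%:R^-1 * \sum_(0 <= t < k) enorm (grad f (center (Theta t))) <=
    n%:R ^+ 2 / (2 * delta * k%:R) *
      (n.+1%:R^-1 * (\sum_(u \in Theta 0%N) f u) - fstar) +
    (n%:R + Num.sqrt n%:R / 2) * nu * delta.
Proof.
pose phi t := set_avg f (Theta t).
set C := (_ + _ / 2) * nu * delta; set K := n%:R ^+ 2 / (2 * delta).
have K_ge0 : 0 <= K by rewrite divr_ge0 ?exprn_ge0 ?mulr_ge0 // ltW.
have step t : enorm (grad f (center (Theta t))) <= K * (phi t - phi t.+1) + C.
  have [x [hx x_lab Theta']] := search_regular_gram t hn hdelta hTheta.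
  by rewrite /phi Theta'; exact: search_step.
have phi_ge : fstar <= phi k.
  have [x [_ [x_inj Thetak _] _]] := search_regular_gram k hn hdelta hTheta.
  rewrite /phi /set_avg Thetak fsbig_range // ler_pdivlMl ?ltr0n //.
  have : \sum_(i < n.+1) fstar <= \sum_i f (x i) by exact: ler_sum.
  by rewrite sumr_const card_ord mulr_natl.
have k_gt0 : 0 < k%:R :> R by rewrite ltr0n.
rewrite ler_pdivrMl //.
have : \sum_(0 <= t < k) enorm (grad f (center (Theta t))) <=
    \sum_(0 <= t < k) (K * (phi t - phi t.+1) + C).
  by apply: ler_sum => t _.
move=> /le_trans; apply.
rewrite big_split /= -mulr_sumr sumr_const_nat subn0.
have -> : \sum_(0 <= t < k) (phi t - phi t.+1) = phi 0%N - phi k.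
  by rewrite -opprB -telescope_sumr // -sumrN; apply: eq_bigr => t _; rewrite opprB.
rewrite [k%:R * _]mulrDr -[C *+ k]mulr_natl lerD2r.
rewrite -/(set_avg f (Theta 0%N)) -/(phi 0%N).
have -> : k%:R * (n%:R ^+ 2 / (2 * delta * k%:R) * (phi 0%N - fstar)) =
    K * (phi 0%N - fstar).
  by rewrite /K; field; rewrite !lt0r_neq0.
by rewrite ler_wpM2l // lerB.
Qed.
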